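(* Let $\xi\in\mathbb{F}_q^{\mathrm{alg}}\subset\mathbb{C}_\infty$ (the algebraic closure of $\mathbb{F}_q$ in $\mathbb{C}_\infty$) satisfy $\xi^{q^r}=\xi$ for an integer $r>0$. Then $$L(\chi_\xi,1)=-\frac{\widetilde{\pi}}{\rho_\xi},$$ where $\rho_\xi\neq0$ is the root $\rho_\xi=(\tau s_{\mathrm{Car}})(\xi)\in\mathbb{C}_\infty$ of the polynomial equation $$X^{q^r-1}=(\xi-\theta^{q^r})(\xi-\theta^{q^{r-1}})\cdots(\xi-\theta^q).$$
   Context: Let $q=p^e$ be a power of a prime $p$ ($e>0$), $A=\mathbb{F}_q[\theta]$ with $\theta$ an indeterminate, $K=\mathbb{F}_q(\theta)$, with absolute value $|a|=q^{\deg_\theta a}$, so $|\theta|=q$. Let $K_\infty=\mathbb{F}_q((1/\theta))$ be the completion of $K$, and $\mathbb{C}_\infty$ the completion of an algebraic closure of $K_\infty$. $A^+$ is the set of monic polynomials of $A$. For $a\in A$, $\chi_\xi(a)=a(\xi)$ is the result of substituting $\xi$ for $\theta$ in $a$, and $L(\chi_\xi,1)=\sum_{a\in A^+}\chi_\xi(a)a^{-1}$, which converges in $\mathbb{C}_\infty$. Carlitz exponential: $e_{\mathrm{Car}}(\eta)=\sum_{n\ge0}\eta^{q^n}/d_n$, where $d_0=1$, $d_i=[i][i-1]^q\cdots[1]^{q^{i-1}}$ and $[i]=\theta^{q^i}-\theta$ for $i>0$. $\widetilde{\pi}$ is a fixed fundamental period of $e_{\mathrm{Car}}$ (a generator of the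 $A$-module $\ker e_{\mathrm{Car}}$), given, for a choice of a $(q-1)$-th root of $-\theta$, by $\widetilde{\pi}=\theta(-\theta)^{1/(q-1)}\prod_{i\ge1}(1-\theta^{1-q^i})^{-1}$. $s_{\mathrm{Car}}(t)=\sum_{i=0}^\infty e_{\mathrm{Car}}(\widetilde{\pi}/\theta^{i+1})t^i=\sum_{n=0}^\infty\frac{\widetilde{\pi}^{q^n}}{d_n(\theta^{q^n}-t)}$, which converges for $|t|<q$. The operator $\tau$ acts on $\mathbb{C}_\infty((t))$ by $\tau\sum c_it^i=\sum c_i^qt^i$; one has $\tau s_{\mathrm{Car}}=(t-\theta)s_{\mathrm{Car}}$. *)

(* Defs.v *)
From HB Require Import structures.
From mathcomp Require Import all_boot all_order all_algebra.
From mathcomp Require Import finmap.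
From mathcomp Require Import all_classical all_reals all_analysis.

Set Implicit Arguments.
Unset Strict Implicit.
Unset Printing Implicit Defensive.

Import Order.TTheory GRing.Theory Num.Theory.

Local Open Scope classical_set_scope.
Local Open Scope ring_scope.

(* Fields with a non-archimedean absolute value, carrying the uniform structure
   it induces.  MathComp's [normedZmodType] cannot be used here: its axiom
   [`|x *+ n| = `|x| *+ n] forces every element of a ring of positive
   characteristic to be 0. *)
HB.mixin Record Uniform_isValuedField (R : realType) E
    of GRing.Field E & Uniform E := {
  vabs : E -> R;
  vabs_ge0 : forall x, 0 <= vabs x;
  vabs_eq0 : forall x, (vabs x == 0) = (x == 0);
  vabsM : {morph vabs : x y / x * y};
  vabsD_max : forall x y, vabs (x + y) <= Num.max (vabs x) (vabs y);
  vabs_entourage :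
    entourage = entourage_ (fun (x : E) (e : R) => [set y | vabs (x - y) < e])
}.

#[short(type="valuedFieldType")]
HB.structure Definition ValuedField (R : realType) :=
  {E of GRing.Field E & Uniform E & Uniform_isValuedField R E}.

Definition complete_space (T : uniformType) : Prop :=
  forall G : set_system T, ProperFilter G -> cauchy G -> exists l : T, G --> l.

(* The limit of a sequence, 0 by convention if there is none; the library's
   [lim] requires a pointed space. *)
Definition vlim (R : realType) (E : valuedFieldType R) (u : E ^nat) : E :=
  xget 0 [set l | u @ \oo --> l].

Definition is_completion (R : realType) (E : fieldType) (absE : E -> R)
    (E' : valuedFieldType R) (i : {rmorphism E -> E'}) : Prop :=
  [/\ forall x, vabs (i x) = absE x, dense (range i) & complete_space E'].

Definition is_algebraic_closure (E E' : fieldType)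
    (j : {rmorphism E -> E'}) : Prop :=
  (forall x : E', algebraicOver j x) /\ GRing.closed_field_axiom E'.

(* The absolute value q ^ deg on A = F[theta] and on its fraction field K. *)
Definition absA (R : realType) (F : finFieldType) (a : {poly F}) : R :=
  if a == 0 then 0 else #|F|%:R ^+ (size a).-1.

Definition absK (R : realType) (F : finFieldType) (x : {fraction {poly F}}) : R :=
  absA R (frac (repr x)).1 / absA R (frac (repr x)).2.

(* C_infty: the completion of an algebraic closure of the completion of K;
   [cinf_vabs_alg] says that the absolute value of the algebraic closure is the
   (unique) one extending that of K_infty. *)
Record cinfty (R : realType) (F : finFieldType) := Cinfty {
  Kinf : valuedFieldType R;
  Kinf_alg : valuedFieldType R;
  Cinf :> valuedFieldType R;
  toKinf : {rmorphism {fraction {poly F}} -> Kinf};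
  toKinf_alg : {rmorphism Kinf -> Kinf_alg};
  toCinf : {rmorphism Kinf_alg -> Cinf};
  cinf_completion : is_completion (@absK R F) toKinf;
  cinf_algclosure : is_algebraic_closure toKinf_alg;
  cinf_vabs_alg : forall x, vabs (toKinf_alg x) = vabs x;
  cinf_completion_alg : is_completion (@vabs R Kinf_alg) toCinf
}.

(* Unconditional summation: limit of the finite partial sums along the directed
   set of finite subsets of the index type. *)
Definition has_sum (R : realType) (C : valuedFieldType R) (I : choiceType)
    (f : I -> C) (l : C) : Prop :=
  (fun J : {fset I} => \sum_(x <- J) f x)
    @ (filter_from setT (fun J0 : {fset I} => [set J | fsubset J0 J])) --> l.

Section Carlitz.
Variables (R : realType) (F : finFieldType) (C : cinfty R F).

Definition embA : {rmorphism {poly F} -> C} :=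
  @toCinf R F C \o (@toKinf_alg R F C \o (@toKinf R F C \o @tofrac _)).

Definition embF (c : F) : C := embA c%:P.

Definition theta : C := embA 'X.

Local Notation q := #|F|.

Definition carlitz_bracket (i : nat) : C := theta ^+ (q ^ i) - theta.

Definition carlitz_d (i : nat) : C :=
  \prod_(1 <= j < i.+1) carlitz_bracket j ^+ (q ^ (i - j)).

Definition e_Car (eta : C) : C :=
  vlim (series (fun n => eta ^+ (q ^ n) / carlitz_d n)).

Definition fundamental_period (w : C) : Prop :=
  forall z : C, e_Car z = 0 <-> exists a : {poly F}, z = embA a * w.

(* A formal power series is represented by its sequence of coefficients. *)
Definition s_Car (w : C) : nat -> C := fun i => e_Car (w / theta ^+ i.+1).

Definition tau (c : nat -> C) : nat -> C := fun i => c i ^+ q.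

Definition ps_eval (c : nat -> C) (x : C) : C :=
  vlim (series (fun i => c i * x ^+ i)).

Definition chi (xi : C) (a : {poly F}) : C := (map_poly embF a).[xi].

(* [L_chi_1 xi l] : the series defining L(chi_xi, 1), indexed by the monic
   polynomials, converges with sum l. *)
Definition L_chi_1 (xi l : C) : Prop :=
  has_sum (fun a : {a : {poly F} | a \is monic} => chi xi (val a) / embA (val a)) l.

End Carlitz.

(* Main.v *)
Require Import Defs.
From mathcomp Require Import all_boot all_order all_algebra all_field.
From mathcomp Require Import finmap.
From mathcomp Require Import all_classical all_reals all_analysis.
From mathcomp Require Import ring lra.

Import Order.TTheory GRing.Theory Num.Theory.
Local Open Scope ring_scope.

(* Let [q = #|F|]. The partial sum of [L(chi_t, 1)] over the monic polynomials of
   degree at most [n] is the product of the [(t - th^(q^i)) / (th - th^(q^i))],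
   [1 <= i <= n]: as polynomials in [t] of degree at most [n], both are 1 at [th]
   and vanish at [th^(q^i)], the former because a sum over an [F]-vector space of
   a product of few linear forms vanishes.

   Let [omega = lam * G], where [lam^(q-1) = - th] and [G] is the power series
   inverse to the product of the [1 - t / th^(q^i)], [i >= 0]. Like [s_Car w], it
   satisfies [tau f = (t - th) f], so its coefficients form a [th]-division tower
   for the Carlitz module; hence [omega = s_Car w0] with
   [w0 = - (tau omega)(th) = th * lam * (tau G)(th)] a period. A comparison of Gauss
   norms shows that [w0] is a constant multiple of the fundamental period, so
   [- piC / rho = (tau G)(th) / (tau G)(xi)], which is the infinite product above. *)

(** * Sums over polynomials of bounded degree *)

Section PowerSums.
Context {F : finFieldType} {E : fieldType} (emb : {rmorphism {poly F} -> E}).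
Local Notation q := #|F|.
Local Notation th := (emb 'X).

Lemma finField_card_gt1 : (1 < q)%N.
Proof. exact: finNzRing_gt1. Qed.

Lemma finField_card_gt0 : (0 < q)%N.
Proof. exact: ltnW finField_card_gt1. Qed.

(** The hypothesis of [exprDn_pchar], on which the additivity of all [q ^ n]-th powers rests. *)
Lemma finField_card_pnat : [pchar E].-nat q.
Proof.
case: (finPcharP F) => p pp pF.
have pE : p \in [pchar E].
  have pA : p \in [pchar {poly F}] by rewrite pchar_poly.
  exact: rmorph_pchar pA.
rewrite (eq_pnat _ (pcharf_eq pE)).
have := @pprimeChar_pgroup p F pF.
by rewrite /pgroup.pgroup cardsT.
Qed.

Lemma expr_card_powD (n : nat) (x y : E) :
  (x + y) ^+ (q ^ n) = x ^+ (q ^ n) + y ^+ (q ^ n).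
Proof. by apply: exprDn_pchar; rewrite pnatX finField_card_pnat. Qed.

Lemma expr_card_pow0 (n : nat) : (0 : E) ^+ (q ^ n) = 0.
Proof. by rewrite expr0n -leqn0 leqNgt expn_gt0 finField_card_gt0. Qed.

Lemma expr_card_powN (n : nat) (x : E) : (- x) ^+ (q ^ n) = - x ^+ (q ^ n).
Proof.
by apply/eqP; rewrite -addr_eq0 -expr_card_powD addNr expr_card_pow0.
Qed.

Lemma expr_card_powB (n : nat) (x y : E) :
  (x - y) ^+ (q ^ n) = x ^+ (q ^ n) - y ^+ (q ^ n).
Proof. by rewrite expr_card_powD expr_card_powN. Qed.

Lemma expr_card_pow_sum (n : nat) (I : Type) (s : seq I) (P : pred I) (f : I -> E) :
  (\sum_(i <- s | P i) f i) ^+ (q ^ n) = \sum_(i <- s | P i) f i ^+ (q ^ n).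
Proof.
exact: (big_morph (fun x => x ^+ (q ^ n)) (expr_card_powD n) (expr_card_pow0 n)).
Qed.

Lemma emb_const_expr_card_pow (n : nat) (c : F) : emb c%:P ^+ (q ^ n) = emb c%:P.
Proof.
elim: n => [|n IHn]; first by rewrite expn0 expr1.
by rewrite expnSr exprM IHn -!rmorphXn /= expf_card.
Qed.

(** The translation by 1 permutes [F], so adding [q%:R] does not change the sum of all elements. *)
Lemma finField_card_natr : q%:R = 0 :> F.
Proof.
have : \sum_(c : F) c = \sum_(c : F) (c + 1) by rewrite [LHS](reindex_inj (addIr 1)).
rewrite big_split /= sumr_const => /eqP.
by rewrite -[X in X == _]addr0 (inj_eq (addrI _)) eq_sym => /eqP.
Qed.

(** For [0 < m], ['X^m - 1] has too few roots to vanish at all [q - 1] nonzero elements; scaling by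
    a non-root [x] permutes [F] and multiplies the sum by [x ^+ m != 1]. *)
Lemma sum_finField_expr (m : nat) : (m < q.-1)%N -> \sum_(c : F) c ^+ m = 0.
Proof.
move=> ltm; have [->|m_gt0] := posnP m.
  (* Since [0 ^+ 0 = 1], all [q] terms are 1. *)
  by under eq_bigr do rewrite expr0; rewrite sumr_const finField_card_natr.
have [x x_neq0 xm] : exists2 x : F, x != 0 & x ^+ m != 1.
  apply: contrapT => nex; have : (size (enum (predC1 (0%R : F))) < m.+1)%N.
    have szX : size ('X^m - 1 : {poly F}) = m.+1 by rewrite -polyC1 size_XnsubC.
    rewrite -szX.
    apply: max_poly_roots (enum_uniq _); first by rewrite -size_poly_gt0 szX.
    apply/allP => x; rewrite mem_enum inE => x_neq0; rewrite rootE !hornerE subr_eq0.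
    by apply: contraT => xm; case: nex; exists x.
  by rewrite -cardE cardC1 ltnS leqNgt ltm.
have : \sum_c c ^+ m = x ^+ m * \sum_c c ^+ m.
  rewrite [LHS](reindex_inj (mulfI x_neq0)) mulr_sumr.
  by apply: eq_bigr => c _; rewrite exprMn.
move/eqP; rewrite -subr_eq0 -{1}[X in X - _]mul1r -mulrBl mulf_eq0 subr_eq0.
by rewrite eq_sym (negPf xm) => /eqP.
Qed.

Lemma sum_const_expr (m : nat) : (m < q.-1)%N -> \sum_(c : F) emb c%:P ^+ m = 0.
Proof.
move=> ltm; under eq_bigr do rewrite -!rmorphXn /=.
by rewrite -!rmorph_sum /= sum_finField_expr // polyC0 rmorph0.
Qed.

(** * Enumeration of polynomials and vanishing of power sums *)

Fixpoint polys (n : nat) : seq {poly F} :=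
  if n is n'.+1 then [seq a * 'X + c%:P | c <- enum F, a <- polys n'] else [:: 0].

Lemma mem_polys (n : nat) (a : {poly F}) : (a \in polys n) = (size a <= n)%N.
Proof.
elim: n a => [|n IHn] a; first by rewrite inE leqn0 size_poly_eq0.
apply/allpairsP/idP => [[[c b] /= [_ hb ->]]|].
  by rewrite size_MXaddC; case: ifP => // _; rewrite ltnS -IHn.
elim/poly_ind: a => [|a c _] hs; last first.
  exists (c, a); split; rewrite ?mem_enum //= IHn.
  by move: hs; rewrite size_MXaddC; case: ifP => [/andP[/eqP-> _]|]; rewrite ?size_poly0.
by exists (0, 0); split; rewrite ?mem_enum ?IHn ?size_poly0 //= mul0r addr0.
Qed.

Lemma polys_uniq (n : nat) : uniq (polys n).
Proof.
elim: n => [|n IHn] //=; apply: allpairs_uniq; rewrite ?enum_uniq //.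
move=> [c a] [d b] _ _ /= /eqP; rewrite -subr_eq0 opprD addrACA -mulrBl -polyCB.
rewrite -size_poly_eq0 size_MXaddC; case: ifP => // /andP[].
by rewrite !subr_eq0 => /eqP-> /eqP->.
Qed.

(** The reason why [polys] appends constant coefficients: sums can be taken over the constant
    coefficient separately. *)
Lemma big_polysS (n : nat) (g : {poly F} -> E) :
  \sum_(a <- polys n.+1) g a
    = \sum_(c : F) \sum_(a <- polys n) g (a * 'X + c%:P).
Proof. by rewrite /= big_allpairs_dep big_enum. Qed.

Definition const_linear (f : {poly F} -> E) : Prop :=
  forall c a b, f (c *: a + b) = emb c%:P * f a + f b.

(** At [a * 'X + c] each factor is [c] times a constant plus a linear form in [a]. In each term of
    the expanded product, either [c] has exponent below [q - 1] and the sum over [c] vanishes, or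
    fewer than [n * q.-1] forms in [a] remain and induction applies. *)
Lemma sum_polys_prod_linear (I : Type) (n : nat) (f : I -> {poly F} -> E)
    (s : seq I) :
  (forall i, const_linear (f i)) -> (size s < n * q.-1)%N ->
  \sum_(a <- polys n) \prod_(i <- s) f i a = 0.
Proof.
elim: n f s => [|n IHn] f s flin; first by rewrite mul0n.
rewrite mulSn => lts; rewrite big_polysS.
pose g i a := f i (a * 'X).
have glin i : const_linear (g i).
  by move=> c a b; rewrite /g mulrDl -scalerAl flin.
have fE i a c : f i (a * 'X + c%:P) = emb c%:P * f i 1 + g i a.
  by rewrite [X in f i X](_ : _ = c *: 1 + a * 'X) ?flin // -mul_polyC mulr1 addrC.
(* Expand the product one factor at a time: [m] factors have contributed the
   constant coefficient [c], the factors indexed by [s'] the remaining ones. *)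
have expand s1 s' m : (m + size s' + size s1 < q.-1 + n * q.-1)%N ->
    \sum_(c : F) emb c%:P ^+ m * \sum_(a <- polys n)
      (\prod_(i <- s') g i a * \prod_(i <- s1) f i (a * 'X + c%:P)) = 0.
  elim: s1 s' m => [|i s1 IHs] s' m.
    rewrite addn0 => lt_ms.
    under eq_bigr do under eq_bigr do rewrite big_nil mulr1.
    rewrite -mulr_suml; case: (ltnP m q.-1) => [/sum_const_expr->|lem].
      by rewrite mul0r.
    by rewrite IHn ?mulr0 // -(ltn_add2l m) (leq_trans lt_ms) ?leq_add2r.
  move=> lt_ms; transitivity
    (f i 1 * (\sum_(c : F) emb c%:P ^+ m.+1 * \sum_(a <- polys n)
       (\prod_(i <- s') g i a * \prod_(i <- s1) f i (a * 'X + c%:P)))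
     + \sum_(c : F) emb c%:P ^+ m * \sum_(a <- polys n)
       (\prod_(i <- i :: s') g i a * \prod_(i <- s1) f i (a * 'X + c%:P))).
    rewrite mulr_sumr -big_split; apply: eq_bigr => c _ /=.
    rewrite exprS !mulr_sumr -big_split; apply: eq_bigr => a _ /=.
    by rewrite !big_cons fE; ring.
  rewrite !IHs ?mulr0 ?addr0 //=; first by rewrite addnS addSn -addnS.
  by rewrite !addSn -addnS.
rewrite -[RHS](expand s [::] 0%N) ?addn0 ?add0n //.
apply: eq_bigr => c _; rewrite expr0 mul1r; apply: eq_bigr => a _.
by rewrite big_nil mul1r.
Qed.

(** As [q ^ i - 1] is [q - 1] times [1 + q + ... + q ^ (i - 1)], the power is a product of
    [q.-1 * i] linear forms [emb a ^+ (q ^ m)], few enough because [i < n]. *)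
Lemma sum_polys_pow (n i : nat) : (0 < i < n)%N ->
  \sum_(a <- polys n) emb a ^+ (q ^ i - 1) = 0.
Proof.
case/andP=> i_gt0 ltin.
pose s := flatten (nseq q.-1 (iota 0 i)).
have szs : size s = (q.-1 * i)%N.
  by rewrite /s size_flatten /shape map_nseq sumn_nseq size_iota mulnC.
rewrite -[RHS](@sum_polys_prod_linear nat n (fun m a => emb a ^+ (q ^ m)) s); first last.
- rewrite szs mulnC ltn_mul2r ltin andbT -subn1 subn_gt0.
  exact: finField_card_gt1.
- move=> m c a b.
  by rewrite -mul_polyC rmorphD rmorphM expr_card_powD exprMn emb_const_expr_card_pow.
apply: eq_bigr => a _.
have -> : \prod_(m <- s) emb a ^+ (q ^ m) = (\prod_(0 <= m < i) emb a ^+ (q ^ m)) ^+ q.-1.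
  rewrite /s; elim: q.-1 => [|k IHk] /=; first by rewrite big_nil.
  by rewrite big_cat exprS IHk /index_iota subn0.
rewrite -expr_sum -exprM; congr (_ ^+ _).
by rewrite subn1 predn_exp mulnC big_mkord.
Qed.

(** * Sums over monic polynomials *)

Definition monics (n : nat) : seq {poly F} := [seq a <- polys n | a \is monic].

(** Each nonzero polynomial is a nonzero constant times a monic one, and the number [q - 1] of these
    constants is -1 in [E]. *)
Lemma sum_polys_homog (n : nat) (g : {poly F} -> E) :
  (forall c a, c != 0 -> g (c *: a) = g a) ->
  \sum_(a <- polys n | a != 0) g a = - \sum_(a <- monics n) g a.
Proof.
move=> ghom.
rewrite (@partition_big _ _ _ _ _ _ _ lead_coef (fun c => c != 0)) /=; last first.
  by move=> a; rewrite lead_coef_eq0.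
have lead c : c != 0 ->
    \sum_(a <- polys n | (a != 0) && (lead_coef a == c)) g a = \sum_(a <- monics n) g a.
  move=> c_neq0; rewrite -big_filter.
  rewrite (perm_big [seq c *: a | a <- monics n]); last first.
    have cK : c^-1 * c = 1 by rewrite mulVf.
    have cK' : c * c^-1 = 1 by rewrite mulfV.
    apply: uniq_perm; rewrite ?filter_uniq ?polys_uniq //.
      rewrite map_inj_uniq ?filter_uniq ?polys_uniq //.
      by apply: (can_inj (g := fun a => c^-1 *: a)) => a; rewrite scalerA cK scale1r.
    move=> a; rewrite mem_filter mem_polys; apply/idP/mapP => [|[b]].
      case/andP=> /andP[_ /eqP lc] sa; exists (c^-1 *: a); last by rewrite scalerA cK' scale1r.
      rewrite mem_filter mem_polys monicE lead_coefZ lc cK eqxx /=.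
      by rewrite size_scale ?invr_eq0.
    rewrite mem_filter mem_polys => /andP[/monicP mb sb] ->.
    by rewrite -lead_coef_eq0 lead_coefZ mb mulr1 c_neq0 eqxx size_scale.
  by rewrite big_map; apply: eq_bigr => a _; rewrite ghom.
rewrite (eq_bigr _ lead) sumr_const cardC1 -mulr_natr.
have -> : (q.-1)%:R = -1 :> E.
  apply/eqP; rewrite -subr_eq0 opprK natr1 prednK ?finField_card_gt0 // -(rmorph_nat emb).
  by rewrite -polyC_natr finField_card_natr rmorph0.
by rewrite mulrN1.
Qed.

Local Notation embc := (emb \o polyC).

(** The [q ^ n]-th power map fixes constants, so it carries evaluation at [th] to evaluation at
    [th ^+ (q ^ n)]. *)
Lemma horner_map_embc (n : nat) (a : {poly F}) :
  (map_poly embc a).[th ^+ (q ^ n)] = emb a ^+ (q ^ n).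
Proof.
elim/poly_ind: a => [|a c IHa]; first by rewrite !rmorph0 horner0 expr_card_pow0.
rewrite rmorphD rmorphM /= map_polyX map_polyC !hornerE IHa.
by rewrite rmorphD rmorphM expr_card_powD exprMn /= emb_const_expr_card_pow.
Qed.

Lemma monicsP (n : nat) (a : {poly F}) :
  (a \in monics n) = (a \is monic) && (size a <= n)%N.
Proof. by rewrite mem_filter mem_polys. Qed.

Lemma sum_polys_nonzero (n : nat) (g : {poly F} -> E) :
  \sum_(a <- polys n | a != 0) g a = \sum_(a <- polys n) g a - g 0.
Proof.
have p0 : 0 \in polys n by rewrite mem_polys size_poly0.
by rewrite [\sum_(a <- polys n) g a](bigD1_seq 0) ?polys_uniq //= addrC addrK.
Qed.

Lemma emb_neq0 (a : {poly F}) : injective emb -> a != 0 -> emb a != 0.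
Proof. by move=> emb_inj a_neq0; rewrite -(rmorph0 emb) (inj_eq emb_inj). Qed.

(* Both sides are polynomials in [x] of degree at most [n] that take the same
   values at the [n + 1] points [th ^+ (q ^ i)], [i <= n]. *)
Lemma sum_monics_horner (n : nat) (x : E) :
  injective emb -> injective (fun i => th ^+ (q ^ i)) ->
  \sum_(a <- monics n.+1) (map_poly embc a).[x] / emb a
    = \prod_(1 <= i < n.+1) ((x - th ^+ (q ^ i)) / (th - th ^+ (q ^ i))).
Proof.
move=> emb_inj th_inj.
pose P := \sum_(a <- monics n.+1) (emb a)^-1 *: map_poly embc a.
pose Q := \prod_(1 <= i < n.+1) ((th - th ^+ (q ^ i))^-1 *: ('X - (th ^+ (q ^ i))%:P)).
have PE y : P.[y] = \sum_(a <- monics n.+1) (map_poly embc a).[y] / emb a.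
  by rewrite horner_sum; apply: eq_bigr => a _; rewrite hornerZ mulrC.
have QE y : Q.[y] = \prod_(1 <= i < n.+1) ((y - th ^+ (q ^ i)) / (th - th ^+ (q ^ i))).
  by rewrite horner_prod; apply: eq_bigr => i _; rewrite hornerZ hornerXsubC mulrC.
have szP : (size P <= n.+1)%N.
  apply: (leq_trans (size_sum _ _ _)); rewrite big_seq_cond.
  apply/bigmax_leqP_seq => a _; rewrite andbT monicsP => /andP[_ sa].
  by rewrite (leq_trans (size_scale_leq _ _)) // size_map_poly.
have szQ : (size Q <= n.+1)%N.
  rewrite /Q; elim: {P PE szP Q QE} n => [|n IHn]; first by rewrite big_nil size_poly1.
  rewrite big_nat_recr //= (leq_trans (size_polyMleq _ _)) //.
  have : (size ((th - th ^+ (q ^ n.+1))^-1 *: ('X - (th ^+ (q ^ n.+1))%:P)) <= 2)%N.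
    by rewrite (leq_trans (size_scale_leq _ _)) // size_XsubC.
  move/(leq_add IHn) => sz_add.
  by rewrite -subn1 leq_subLR add1n (leq_trans sz_add) // addn2.
have Pth i : (i < n.+1)%N -> P.[th ^+ (q ^ i)] = (i == 0%N)%:R.
  move=> lti; rewrite PE.
  (* The summand becomes a power of exponent [q ^ i - 1], unchanged when [a] is scaled by a nonzero
     constant; so the sum can be extended to all nonzero [a]. *)
  rewrite (eq_big_seq (fun a => emb a ^+ (q ^ i - 1))); last first.
    move=> a; rewrite monicsP => /andP[/monic_neq0 a_neq0 _].
    rewrite horner_map_embc -{1}(subnK (_ : 1 <= q ^ i)%N) ?expn_gt0 ?finField_card_gt0 //.
    by rewrite addn1 exprSr mulfK // emb_neq0.
  rewrite -[LHS]opprK -sum_polys_homog; last first.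
    move=> c a c_neq0; rewrite -mul_polyC rmorphM exprMn.
    have c1 : emb c%:P ^+ (q ^ i - 1) = 1.
      apply: (mulIf (emb_neq0 _ emb_inj (_ : c%:P != 0))); first by rewrite polyC_eq0.
      rewrite -exprSr subn1 prednK ?expn_gt0 ?finField_card_gt0 //.
      by rewrite emb_const_expr_card_pow mul1r.
    by rewrite c1 mul1r.
  rewrite sum_polys_nonzero; case: i lti => [|i] lti.
    (* For [i = 0] the exponent is 0: the sum of ones over [polys n.+1] vanishes, being the case of
       an empty product of forms, and the subtracted term at [a = 0] is 1. *)
    rewrite subnn expr0 -[X in X - _](_ : \sum_(a <- polys n.+1)
      \prod_(i <- [::] : seq nat) (fun=> emb) i a = _).
      rewrite sum_polys_prod_linear ?sub0r ?opprK //.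
        by move=> _ c a b; rewrite -mul_polyC rmorphD rmorphM.
      by rewrite muln_gt0 /= -subn1 subn_gt0 finField_card_gt1.
    by apply: eq_bigr => a _; rewrite big_nil.
  rewrite sum_polys_pow // rmorph0 expr0n sub0r opprK.
  by rewrite subn_eq0 leqNgt -{1}(exp1n i.+1) ltn_exp2r // finField_card_gt1.
have Qth i : (i < n.+1)%N -> Q.[th ^+ (q ^ i)] = (i == 0%N)%:R.
  move=> lti; rewrite QE; case: i lti => [|i] lti.
    rewrite expn0 expr1 big_nat big1 // => j /andP[j_gt0 _].
    rewrite divff // subr_eq0 -[X in X == _]expr1 -(expn0 q).
    by rewrite (inj_eq th_inj) ltn_eqF.
  by rewrite (bigD1_seq i.+1) ?mem_index_iota ?iota_uniq //= subrr mul0r mul0r.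
rewrite -PE -QE; congr (_.[x]); apply/eqP; rewrite -subr_eq0; apply/eqP.
apply: (@roots_geq_poly_eq0 _ _ [seq th ^+ (q ^ i) | i <- iota 0 n.+1]).
- apply/allP => _ /mapP[i + ->]; rewrite mem_iota add0n /= => lti.
  by rewrite rootE hornerD hornerN Pth // Qth // subrr.
- by rewrite map_inj_uniq // iota_uniq.
- by rewrite size_map size_iota (leq_trans (size_polyD _ _)) // geq_max szP size_polyN.
Qed.

End PowerSums.
(** * Convergence in non-archimedean valued fields *)

Section ValuedField.
Set Implicit Arguments.
Unset Strict Implicit.
Import numFieldNormedType.Exports.
Context {R : realType} {E : valuedFieldType R}.
Implicit Types (x y : E) (u v : nat -> E).
Local Open Scope classical_set_scope.

Lemma vabs0 : vabs (0 : E) = 0.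
Proof. by apply/eqP; rewrite vabs_eq0. Qed.

Lemma vabs_gt0 x : (0 < vabs x) = (x != 0).
Proof. by rewrite lt_def vabs_ge0 andbT vabs_eq0. Qed.

Lemma vabs1 : vabs (1 : E) = 1.
Proof.
have : vabs (1 : E) != 0 by rewrite vabs_eq0 oner_neq0.
by move/mulIf; apply; rewrite -vabsM !mul1r.
Qed.

Lemma vabsX x (n : nat) : vabs (x ^+ n) = vabs x ^+ n.
Proof. by elim: n => [|n IHn]; rewrite ?expr0 ?vabs1 // !exprS vabsM IHn. Qed.

Lemma vabsN x : vabs (- x) = vabs x.
Proof.
apply/eqP; rewrite -(@eqrXn2 _ 2) ?vabs_ge0 //.
by rewrite -!vabsX sqrrN.
Qed.

Lemma vabsB x y : vabs (x - y) = vabs (y - x).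
Proof. by rewrite -vabsN opprB. Qed.

Lemma vabsV x : vabs x^-1 = (vabs x)^-1.
Proof.
have [->|x0] := eqVneq x 0; first by rewrite invr0 vabs0 invr0.
have vx0 : vabs x != 0 by rewrite vabs_eq0.
by apply: (mulIf vx0); rewrite mulVf // -vabsM mulVf // vabs1.
Qed.

Lemma vabs_expr1 x (n : nat) : (0 < n)%N -> x ^+ n = 1 -> vabs x = 1.
Proof.
move=> n_gt0 xn; apply/eqP; rewrite -(@eqrXn2 _ n) ?vabs_ge0 //.
by rewrite -vabsX xn vabs1 expr1n.
Qed.

Lemma vabsD_le x y (M : R) : vabs x <= M -> vabs y <= M -> vabs (x + y) <= M.
Proof. by move=> xM yM; rewrite (le_trans (vabsD_max x y)) // ge_max xM. Qed.

Lemma vabsB_le x y (M : R) : vabs x <= M -> vabs y <= M -> vabs (x - y) <= M.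
Proof. by move=> xM yM; rewrite vabsD_le // vabsN. Qed.

Lemma vabs_sum_le (I : eqType) (s : seq I) (f : I -> E) (M : R) : 0 <= M ->
  {in s, forall i, vabs (f i) <= M} -> vabs (\sum_(i <- s) f i) <= M.
Proof.
move=> M0 fM; rewrite big_seq; elim/big_ind: _ => //; first by rewrite vabs0.
by move=> x y; apply: vabsD_le.
Qed.

Lemma vabs_sum_lt (I : eqType) (s : seq I) (f : I -> E) (M : R) : 0 < M ->
  {in s, forall i, vabs (f i) < M} -> vabs (\sum_(i <- s) f i) < M.
Proof.
move=> M0 fM; rewrite big_seq; elim/big_ind: _ => //; first by rewrite vabs0.
by move=> x y xM yM; rewrite (le_lt_trans (vabsD_max x y)) // gt_max xM.
Qed.

(** Otherwise [x = (x + y) - y] would be a sum of two elements of value less than [vabs x]. *)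
Lemma vabsD_dominant x y : vabs y < vabs x -> vabs (x + y) = vabs x.
Proof.
move=> yx; apply/eqP; rewrite eq_le vabsD_le ?(ltW yx) //= leNgt; apply/negP => xyx.
have := vabsD_max (x + y) (- y); rewrite addrK vabsN leNgt.
by rewrite gt_max xyx yx.
Qed.

(** Convergence as a real limit, to which squeezing in [R] applies; [vcvgP] translates it back to
    the uniform structure. *)
Definition vcvg u x := (fun n => vabs (u n - x)) @ \oo --> (0 : R).

Lemma vcvgP u x : u @ \oo --> x <-> vcvg u x.
Proof.
rewrite cvg_entourageP vabs_entourage; split=> [ux|ux A [e /= e0 sub]].
  apply/cvgr0Pnorm_lt => e e0.
  have [|N _ NP] := ux [set xy | vabs (xy.1 - xy.2) < e]; first by exists e.
  by exists N => // n /NP /=; rewrite vabsB ger0_norm ?vabs_ge0.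
have /cvgr0Pnorm_lt/(_ e e0)[N _ NP] := ux.
exists N => // n /NP /=; rewrite ger0_norm ?vabs_ge0 // vabsB => lte.
exact: sub.
Qed.

Lemma vcvg_squeeze u x (b : nat -> R) : (\forall n \near \oo, vabs (u n - x) <= b n) ->
  b @ \oo --> (0 : R) -> vcvg u x.
Proof.
move=> ub b0; apply: squeeze_cvgr b0; last exact: cvg_cst.
by near=> n; rewrite vabs_ge0 /=; near: n.
Unshelve. all: by end_near. Qed.

Lemma vcvg_cst x : vcvg (fun=> x) x.
Proof. by rewrite /vcvg subrr vabs0; apply: cvg_cst. Qed.

Lemma vcvgD u v x y : vcvg u x -> vcvg v y -> vcvg (fun n => u n + v n) (x + y).
Proof.
move=> ux vy; have h : (fun n => vabs (u n - x) + vabs (v n - y)) @ \oo --> (0 : R).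
  by rewrite -[0 : R]addr0; apply: cvgD.
apply: vcvg_squeeze h.
near=> n; rewrite opprD addrACA (le_trans (vabsD_max _ _)) // ge_max.
by rewrite lerDl lerDr !vabs_ge0.
Unshelve. all: by end_near. Qed.

Lemma vcvgM u v x y : vcvg u x -> vcvg v y -> vcvg (fun n => u n * v n) (x * y).
Proof.
move=> ux vy.
have h : (fun n => vabs (u n - x) * vabs (v n - y) + vabs x * vabs (v n - y)
                   + vabs y * vabs (u n - x)) @ \oo --> (0 : R).
  rewrite (_ : 0 = 0 * 0 + vabs x * 0 + vabs y * 0); last by rewrite !mulr0 !addr0.
  by apply: cvgD; [apply: cvgD|]; apply: cvgM => //; apply: cvg_cst.
apply: vcvg_squeeze h; near=> n.
rewrite (_ : _ - _ = (u n - x) * (v n - y) + x * (v n - y) + y * (u n - x)); last by ring.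
have [ab xb ya] : [/\ 0 <= vabs (u n - x) * vabs (v n - y),
    0 <= vabs x * vabs (v n - y) & 0 <= vabs y * vabs (u n - x)].
  by split; rewrite mulr_ge0 ?vabs_ge0.
by apply: vabsD_le; [apply: vabsD_le|]; rewrite vabsM; lra.
Unshelve. all: by end_near. Qed.

Lemma vcvgMr u x y : vcvg u x -> vcvg (fun n => y * u n) (y * x).
Proof. by move=> ux; apply: vcvgM ux; apply: vcvg_cst. Qed.

Lemma vcvgB u v x y : vcvg u x -> vcvg v y -> vcvg (fun n => u n - v n) (x - y).
Proof.
move=> ux vy; rewrite -mulN1r; under eq_fun do rewrite -mulN1r.
by apply: vcvgD => //; apply: vcvgMr.
Qed.

Lemma vcvgX u x (m : nat) : vcvg u x -> vcvg (fun n => u n ^+ m) (x ^+ m).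
Proof.
move=> ux; elim: m => [|m IHm]; first exact: vcvg_cst.
by rewrite exprS; under eq_fun do rewrite exprS; apply: vcvgM.
Qed.

Lemma vcvgS u x : vcvg (fun n => u n.+1) x <-> vcvg u x.
Proof. by rewrite /vcvg -(@cvg_shiftS _ (fun n => vabs (u n - x))). Qed.

Lemma vcvg_unique u x y : vcvg u x -> vcvg u y -> x = y.
Proof.
move=> ux uy; have := vcvgB ux uy; rewrite /vcvg.
under eq_fun do rewrite subrr sub0r vabsN.
move=> xy; apply/eqP; rewrite -subr_eq0 -vabs_eq0; apply/eqP.
exact: (cvg_unique (@norm_hausdorff _ _) (cvg_cst _) xy).
Qed.

Lemma vlim_vcvg u x : vcvg u x -> vlim u = x.
Proof.
move=> ux; apply: xget_unique; first exact/vcvgP.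
by move=> y /vcvgP uy; apply: vcvg_unique uy ux.
Qed.

Lemma vcvg_vabs_le u x (M : R) (N : nat) :
  vcvg u x -> (forall n, (N <= n)%N -> vabs (u n) <= M) -> vabs x <= M.
Proof.
move=> ux uM; rewrite leNgt; apply/negP => Mx.
have M0 : 0 <= M by rewrite (le_trans (vabs_ge0 (u N))) ?uM.
have x_gt0 := le_lt_trans M0 Mx.
have /cvgr0Pnorm_lt/(_ _ x_gt0)[N' _ NP] := ux.
have := NP (maxn N N') (leq_maxr _ _); have := uM _ (leq_maxl N N').
set y := u _ => yM; rewrite /= ger0_norm ?vabs_ge0 // => yx.
have : vabs (y - (y - x)) < vabs x.
  by rewrite (le_lt_trans (vabsD_max _ _)) // gt_max vabsN yx (le_lt_trans yM).
by rewrite opprB addrCA subrr addr0 ltxx.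
Qed.

Lemma vcvg0_vabs u : vcvg u 0 <-> ((fun n => vabs (u n)) @ \oo --> (0 : R)).
Proof. by rewrite /vcvg; under eq_fun do rewrite subr0. Qed.

(** By the ultrametric inequality a block of terms is no larger than its largest term, so terms
    tending to 0 make the partial sums Cauchy. *)
Lemma vcvg_series u : complete_space E -> vcvg u 0 ->
  exists x, vcvg (series u) x.
Proof.
move=> E_complete /vcvg0_vabs/cvgr0Pnorm_lt u0.
have [|x sx] := E_complete (series u @ \oo) _ _; last by exists x; apply/vcvgP.
move=> A; rewrite /= vabs_entourage => -[e /= e0 sub].
have [N _ NP] := u0 e e0.
have tail n : (N <= n)%N -> vabs (series u n - series u N) < e.
  move=> leNn; rewrite sub_series_geq // vabs_sum_lt // => i.
  rewrite mem_index_iota => /andP[leNi _].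
  by have := NP i leNi; rewrite /= ger0_norm ?vabs_ge0.
exists ([set y | vabs (y - series u N) < e], [set y | vabs (y - series u N) < e]).
  by split; exists N => // n; apply: tail.
move=> [y z] [/= yN zN]; apply: sub => /=.
rewrite (_ : y - z = (y - series u N) + (series u N - z)); last by ring.
by rewrite (le_lt_trans (vabsD_max _ _)) // gt_max yN vabsB.
Qed.

Lemma vcvg_series_le u x (M : R) :
  0 <= M -> vcvg (series u) x -> (forall n, vabs (u n) <= M) -> vabs x <= M.
Proof.
move=> M0 sx uM; apply: (vcvg_vabs_le (N := 0) sx) => n _.
by apply: vabs_sum_le.
Qed.

(** A finite superset of [J n] only adds terms of value below [e], hence a sum of value below
    [e]. *)
Lemma has_sum_exhaustion (I : choiceType) (f : I -> E) (x : E) (J : nat -> {fset I}) :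
  vcvg (fun n => \sum_(i <- J n) f i) x ->
  (forall e : R, 0 < e -> \forall n \near \oo, forall i, i \notin J n -> vabs (f i) < e) ->
  has_sum f x.
Proof.
move=> /cvgr0Pnorm_lt Jx f0.
have FF : Filter (filter_from setT (fun J0 : {fset I} => [set J' | fsubset J0 J'])).
  apply: filter_fromT_filter; first by exists fset0.
  move=> J1 J2; exists (J1 `|` J2)%fset => J' /= subJ.
  by split=> /=; apply: fsubset_trans subJ; [apply: fsubsetUl|apply: fsubsetUr].
rewrite /has_sum cvg_entourageP vabs_entourage => A [e /= e0 sub].
have [N [/= Nx Nf]] : exists N, `|vabs (\sum_(i <- J N) f i - x)| < e
    /\ forall i, i \notin J N -> vabs (f i) < e.
  near \oo => n; exists n; split; near: n; [exact: Jx|exact: f0].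
exists (J N) => // J' /= subJ; apply: sub => /=.
rewrite (big_fsetID _ (mem (J N))) /=.
have -> : [fset i in J' | i \in J N]%fset = J N.
  by apply/fsetP => i; rewrite !inE andbC; case: (boolP (i \in J N)) => // /(fsubsetP subJ).
rewrite opprD addrA (le_lt_trans (vabsD_max _ _)) // gt_max vabsB.
rewrite ger0_norm ?vabs_ge0 // in Nx; rewrite Nx vabsN vabs_sum_lt // => i.
by rewrite !inE => /andP[_ /Nf].
Unshelve. all: by end_near. Qed.

End ValuedField.
(** * The Carlitz exponential and the omega function *)

Section Cinfty.
Import numFieldNormedType.Exports.
Set Implicit Arguments.
Unset Strict Implicit.
Context {R : realType} {F : finFieldType} (C : cinfty R F).
Local Notation q := #|F|.
Local Notation th := (theta C).
Local Notation emb := (embA C).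
Local Notation qR := (q%:R : R).
Implicit Types (x y z t xi : C).
Local Open Scope classical_set_scope.

(** * The absolute value and the Frobenius powers on [C] *)

Lemma absA_M (a b : {poly F}) : absA R (a * b) = absA R a * absA R b.
Proof.
rewrite /absA mulf_eq0; have [->|a0] := eqVneq a 0; first by rewrite /= mul0r.
have [->|b0] /= := eqVneq b 0; first by rewrite mulr0.
rewrite -exprD size_mul //; congr (_ ^+ _).
move: a0 b0; rewrite -!size_poly_gt0.
by case: (size a) (size b) => [|m] [|n] //= _ _; rewrite addnS.
Qed.

Lemma cardR_gt1 : 1 < qR.
Proof. by rewrite ltr1n finField_card_gt1. Qed.

Lemma cardR_gt0 : 0 < qR.
Proof. exact: lt_trans ltr01 cardR_gt1. Qed.

Lemma absA_eq0 (a : {poly F}) : (absA R a == 0) = (a == 0).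
Proof.
rewrite /absA; case: ifP => _; first by rewrite eqxx.
by rewrite expf_eq0 gt_eqF ?cardR_gt0 // andbF.
Qed.

(** [absK] is read off a chosen representative; here its numerator is [a] times its denominator. *)
Lemma absK_tofrac (a : {poly F}) : absK R (tofrac a) = absA R a.
Proof.
have : (\pi_({fraction {poly F}}) (repr (tofrac a)) == \pi_({fraction {poly F}}) (Ratio a 1))%qT.
  by rewrite reprK piE.
rewrite FracField.equivf_def !numden_Ratio ?oner_neq0 // mulr1 => /eqP num.
rewrite /absK num.
by rewrite absA_M mulrAC mulfV ?mul1r // absA_eq0 denom_ratioP.
Qed.

Lemma vabs_embA (a : {poly F}) : vabs (emb a) = absA R a.
Proof.
rewrite /embA /=.
case: (cinf_completion_alg C) => -> _ _; rewrite cinf_vabs_alg.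
by case: (cinf_completion C) => -> _ _; rewrite absK_tofrac.
Qed.

Lemma Cinf_complete : complete_space C.
Proof. by case: (cinf_completion_alg C). Qed.

Lemma embA_inj : injective emb.
Proof.
move=> a b /eqP; rewrite -subr_eq0 -rmorphB -vabs_eq0 vabs_embA absA_eq0 subr_eq0.
by move/eqP.
Qed.

Lemma vabs_theta : vabs th = qR.
Proof. by rewrite vabs_embA /absA polyX_eq0 size_polyX expr1. Qed.

Lemma theta_neq0 : th != 0.
Proof. by rewrite -vabs_eq0 vabs_theta gt_eqF ?cardR_gt0. Qed.

Lemma vabs_embF_le1 (c : F) : vabs (embF C c) <= 1.
Proof.
rewrite vabs_embA /absA; case: ifP => // _; rewrite size_polyC.
by case: (c != 0); rewrite ?expr0.
Qed.

Lemma vabs_embF (c : F) : c != 0 -> vabs (embF C c) = 1.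
Proof. by move=> c0; rewrite vabs_embA /absA polyC_eq0 (negPf c0) size_polyC c0 expr0. Qed.

Lemma theta_pow_inj : injective (fun i => th ^+ (q ^ i)).
Proof.
move=> i j /(congr1 vabs) /=; rewrite !vabsX vabs_theta => qij; apply/eqP.
rewrite -(@eqn_exp2l q) ?finField_card_gt1 //; apply/eqP.
by apply: (ieexprIn cardR_gt0 _ qij); rewrite gt_eqF ?cardR_gt1.
Qed.

Lemma cvg_geometric0 (a b : R) : 0 <= b < 1 -> (fun n => a * b ^+ n) @ \oo --> (0 : R).
Proof.
case/andP=> b0 b1; rewrite -(mulr0 a).
by apply: cvgM; [exact: cvg_cst|apply: cvg_expr; rewrite ger0_norm].
Qed.

Lemma invq_ge0_lt1 : 0 <= qR^-1 < 1.
Proof. by rewrite invr_ge0 ltW ?cardR_gt0 // invf_lt1 ?cardR_gt0 ?cardR_gt1. Qed.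

Lemma Frob_D n x y : (x + y) ^+ (q ^ n) = x ^+ (q ^ n) + y ^+ (q ^ n).
Proof. exact: (expr_card_powD emb). Qed.

Lemma Frob1_B x y : (x - y) ^+ q = x ^+ q - y ^+ q.
Proof. by have := expr_card_powB emb 1 x y; rewrite expn1. Qed.

Lemma Frob1_sum (I : Type) (s : seq I) (f : I -> C) :
  (\sum_(i <- s) f i) ^+ q = \sum_(i <- s) f i ^+ q.
Proof. by have := expr_card_pow_sum emb 1 I s predT f; rewrite expn1. Qed.

Lemma embF_Frob n (c : F) : embF C c ^+ (q ^ n) = embF C c.
Proof. exact: emb_const_expr_card_pow. Qed.

Lemma vabs_theta_powM (n : nat) x : vabs (x / th ^+ n) = vabs x * qR^-1 ^+ n.
Proof. by rewrite vabsM vabsV vabsX vabs_theta exprVn. Qed.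

(** * Size of the [carlitz_d], and the functional equation of the exponential *)

Lemma vabs_bracket (i : nat) : (0 < i)%N -> vabs (carlitz_bracket C i) = qR ^+ (q ^ i).
Proof.
move=> i_gt0; rewrite /carlitz_bracket vabsD_dominant ?vabsX ?vabs_theta //.
rewrite vabsN vabs_theta -[ltLHS]expr1 ltr_eXn2l ?cardR_gt1 //.
by rewrite -(exp1n i) ltn_exp2r ?finField_card_gt1.
Qed.

Lemma carlitz_dS (n : nat) :
  carlitz_d C n.+1 = carlitz_bracket C n.+1 * carlitz_d C n ^+ q.
Proof.
rewrite /carlitz_d big_nat_recr //= subnn expn0 expr1 mulrC; congr (_ * _).
rewrite -prodrXl big_nat_cond [RHS]big_nat_cond; apply: eq_bigr => j /andP[/andP[_ ltj] _].
by rewrite -exprM -expnSr subSn.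
Qed.

Lemma carlitz_d0 : carlitz_d C 0 = 1.
Proof. by rewrite /carlitz_d big_geq. Qed.

(** The exponent [n * q ^ n] is kept split so that a term of [e_Car z] has as value the [q ^ n]-th
    power of [vabs z * qR^-1 ^+ n]. *)
Lemma vabs_carlitz_d (n : nat) : vabs (carlitz_d C n) = (qR ^+ n) ^+ (q ^ n).
Proof.
elim: n => [|n IHn]; first by rewrite carlitz_d0 vabs1 expr0 expr1n.
rewrite carlitz_dS vabsM vabs_bracket // vabsX IHn -exprM -expnSr -!exprM -exprD.
by rewrite mulSn.
Qed.

Lemma carlitz_d_neq0 (n : nat) : carlitz_d C n != 0.
Proof. by rewrite -vabs_eq0 vabs_carlitz_d !expf_eq0 gt_eqF ?cardR_gt0 // !andbF. Qed.

Lemma carlitz_bracket_neq0 (n : nat) : (0 < n)%N -> carlitz_bracket C n != 0.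
Proof. by move=> n0; rewrite -vabs_eq0 vabs_bracket // expf_eq0 gt_eqF ?cardR_gt0 // andbF. Qed.

Definition e_Car_term z (n : nat) : C := z ^+ (q ^ n) / carlitz_d C n.

Lemma vabs_e_Car_term z (n : nat) : vabs (e_Car_term z n) = (vabs z * qR^-1 ^+ n) ^+ (q ^ n).
Proof. by rewrite /e_Car_term vabsM vabsV vabs_carlitz_d vabsX exprMn exprVn exprVn. Qed.

Lemma cvg_e_Car_term z : vcvg (e_Car_term z) 0.
Proof.
apply: vcvg_squeeze (cvg_geometric0 (vabs z) invq_ge0_lt1).
have /cvgr0Pnorm_lt/(_ 1 ltr01) := cvg_geometric0 (vabs z) invq_ge0_lt1.
apply: filterS => n; rewrite /= subr0 vabs_e_Car_term.
have b0 : 0 <= vabs z * qR^-1 ^+ n by rewrite mulr_ge0 ?vabs_ge0 ?exprn_ge0 ?invr_ge0 ?ler0n.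
rewrite ger0_norm // => b1; rewrite ler_iXnr //; first by rewrite expn_gt0 finField_card_gt0.
exact: ltW.
Qed.

Lemma e_Car_vcvg z : vcvg (series (e_Car_term z)) (e_Car z).
Proof.
have [x sx] := vcvg_series (@Cinf_complete) (cvg_e_Car_term z).
by rewrite /e_Car (vlim_vcvg sx).
Qed.

Lemma e_CarD x y : e_Car (x + y) = e_Car x + e_Car y.
Proof.
apply: vlim_vcvg; rewrite -[X in series X]/(e_Car_term (x + y)).
have -> : e_Car_term (x + y) = (fun n => e_Car_term x n + e_Car_term y n).
  by apply/funext => n; rewrite /e_Car_term Frob_D mulrDl.
have := vcvgD (e_Car_vcvg x) (e_Car_vcvg y).
by under eq_fun do rewrite /series /= -big_split.
Qed.

Lemma e_CarZ (c : F) x : e_Car (embF C c * x) = embF C c * e_Car x.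
Proof.
apply: vlim_vcvg; rewrite -[X in series X]/(e_Car_term (embF C c * x)).
have -> : e_Car_term (embF C c * x) = (fun n => embF C c * e_Car_term x n).
  by apply/funext => n; rewrite /e_Car_term exprMn embF_Frob mulrA.
have := vcvgMr (embF C c) (e_Car_vcvg x).
by under eq_fun do rewrite /series /= mulr_sumr.
Qed.

Lemma e_Car0 : e_Car (0 : C) = 0.
Proof. by have := e_CarZ 0 0; rewrite /embF rmorph0 !mul0r. Qed.

Lemma e_Car_sum (I : Type) (s : seq I) (f : I -> C) :
  e_Car (\sum_(i <- s) f i) = \sum_(i <- s) e_Car (f i).
Proof. exact: (big_morph _ e_CarD e_Car0). Qed.

Lemma e_Car_term0 z : e_Car_term z 0 = z.
Proof. by rewrite /e_Car_term carlitz_d0 divr1 expr1. Qed.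

(** Split [th ^+ (q ^ n.+1)] as the bracket plus [th]; by [carlitz_dS] the bracket cancels against
    [carlitz_d C n.+1], leaving [carlitz_d C n ^+ q]. *)
Lemma e_Car_term_theta z (n : nat) :
  e_Car_term (th * z) n.+1 = th * e_Car_term z n.+1 + e_Car_term z n ^+ q.
Proof.
rewrite /e_Car_term exprMn -[X in X * _ / _](subrK th) -/(carlitz_bracket C n.+1).
rewrite exprMn exprVn -exprM -expnSr mulrDl mulrDl addrC; congr (_ + _); first by rewrite !mulrA.
rewrite carlitz_dS; field.
by rewrite carlitz_bracket_neq0 // expf_neq0 // carlitz_d_neq0.
Qed.

(** The right-hand side is the action of [th] by the Carlitz module. The index shift sets aside the
    term at 0, which has no Frobenius part. *)
Lemma e_Car_theta z : e_Car (th * z) = th * e_Car z + e_Car z ^+ q.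
Proof.
apply: vlim_vcvg; apply/vcvgS; rewrite -[X in series X]/(e_Car_term (th * z)).
have := vcvgD (vcvgMr th (iffRL (vcvgS _ _) (e_Car_vcvg z))) (vcvgX q (e_Car_vcvg z)).
congr vcvg; apply/funext => n.
rewrite /series /= !big_nat_recl //= !e_Car_term0 Frob1_sum mulrDr -addrA; congr (_ + _).
by rewrite mulr_sumr -big_split; apply: eq_bigr => i _ /=; rewrite e_Car_term_theta.
Qed.

(** All terms after the first carry [z] to a power at least [q >= 2]. *)
Lemma e_Car_approx z : vabs z <= 1 -> vabs (e_Car z - z) <= vabs z ^+ 2.
Proof.
move=> z1; have := vcvgB (e_Car_vcvg z) (vcvg_cst z).
move/(@vcvg_vabs_le _ _ _ _ _ 1%N); apply => -[|n] // _.
rewrite /series /= big_nat_recl //= e_Car_term0 addrC addKr.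
apply: vabs_sum_le => [|i _]; first by rewrite exprn_ge0 ?vabs_ge0.
rewrite vabs_e_Car_term exprMn -[leRHS]mulr1 ler_pM ?exprn_ge0 ?vabs_ge0 ?invr_ge0 ?ler0n //.
  rewrite ler_wiXn2l ?vabs_ge0 //.
  by rewrite (leq_trans (@finField_card_gt1 F)) // -{1}(expn1 q) leq_exp2l ?finField_card_gt1.
by case/andP: invq_ge0_lt1 => b0 /ltW b1; rewrite !exprn_ile1 ?exprn_ge0.
Qed.

(** * The series [G] and its twists *)

(* The small root of the Artin-Schreier equation [X - X ^+ q = y]. *)
Definition artin_schreier_root y : C := vlim (series (fun k => y ^+ (q ^ k))).

Lemma artin_schreier_vcvg y : vabs y < 1 ->
  vcvg (series (fun k => y ^+ (q ^ k))) (artin_schreier_root y).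
Proof.
move=> y1; have [|x sx] := vcvg_series (@Cinf_complete) (u := fun k => y ^+ (q ^ k)).
  have yb : 0 <= vabs y < 1 by rewrite vabs_ge0.
  apply: vcvg_squeeze (cvg_geometric0 1 yb); near=> k.
  rewrite subr0 vabsX mul1r ler_wiXn2l ?vabs_ge0 ?(ltW y1) //.
  exact: ltnW (ltn_expl _ (@finField_card_gt1 F)).
by rewrite /artin_schreier_root (vlim_vcvg sx).
Unshelve. all: by end_near. Qed.

(** The [q]-th power shifts the series by one term. *)
Lemma artin_schreier_rootE y : vabs y < 1 ->
  artin_schreier_root y ^+ q = artin_schreier_root y - y.
Proof.
move=> y1; have sy := artin_schreier_vcvg y1; apply: (vcvg_unique (vcvgX q sy)).
have := vcvgB (iffRL (vcvgS _ _) sy) (vcvg_cst y).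
congr vcvg; apply/funext => n.
rewrite /series /= big_nat_recl //= expn0 expr1 addrC addKr Frob1_sum.
by apply: eq_bigr => i _; rewrite -exprM -expnSr.
Qed.

Lemma vabs_artin_schreier_root y : vabs y < 1 -> vabs (artin_schreier_root y) <= vabs y.
Proof.
move=> y1; apply: (vcvg_series_le (vabs_ge0 y) (artin_schreier_vcvg y1)) => n.
by rewrite vabsX ler_iXnr ?expn_gt0 ?finField_card_gt0 ?vabs_ge0 ?(ltW y1).
Qed.

(* The coefficients of the series [G] inverse to the product of the
   [1 - t / th ^+ (q ^ i)], [i >= 0], obtained from [tau G = (1 - t / th) G]. *)
Fixpoint omega_coef (i : nat) : C :=
  if i is i'.+1 then artin_schreier_root (omega_coef i' / th) else 1.

Lemma vabs_omega_coef (i : nat) : vabs (omega_coef i) <= qR^-1 ^+ i.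
Proof.
elim: i => [|i IHi] /=; first by rewrite vabs1 expr0.
have := invq_ge0_lt1 => /andP[b0 b1].
have le_gam : vabs (omega_coef i / th) <= qR^-1 ^+ i.+1.
  by rewrite -[th]expr1 vabs_theta_powM expr1 exprSr; apply: ler_wpM2r.
rewrite (le_trans _ le_gam) // vabs_artin_schreier_root // (le_lt_trans le_gam) //.
by rewrite exprn_ilt1.
Qed.

(** The coefficient of [t ^+ i.+1] in [tau G = (1 - t / th) G]. *)
Lemma omega_coefE (i : nat) : omega_coef i.+1 ^+ q = omega_coef i.+1 - omega_coef i / th.
Proof.
apply: artin_schreier_rootE; have := invq_ge0_lt1 => /andP[b0 b1].
rewrite -[th]expr1 vabs_theta_powM expr1 (le_lt_trans _ b1) // ler_piMl //.
by rewrite (le_trans (vabs_omega_coef i)) // exprn_ile1 // ltW.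
Qed.

Definition omega_term (m : nat) t (i : nat) : C := omega_coef i ^+ (q ^ m) * t ^+ i.

(* [tau^m G] evaluated at [t]; converges for [m > 0] and [vabs t <= q]. *)
Definition omega_twist (m : nat) t : C := vlim (series (omega_term m t)).

Lemma invq_pow_ge0_lt1 (m : nat) : (0 < m)%N -> 0 <= qR^-1 ^+ m < 1.
Proof.
move=> m_gt0; have := invq_ge0_lt1 => /andP[b0 b1].
by rewrite exprn_ge0 ?exprn_ilt1 // -lt0n.
Qed.

Lemma vabs_omega_term (m i : nat) t : (0 < m)%N -> vabs t <= qR ->
  vabs (omega_term m t i) <= (qR^-1 ^+ m) ^+ i.
Proof.
move=> m_gt0 tq; have := invq_ge0_lt1 => /andP[b0 /ltW b1].
rewrite /omega_term vabsM !vabsX.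
(* Since [m.+1 <= q ^ m], there are [m.+1] factors [qR^-1 ^+ i]; one of them pays for [t ^+ i], even
   when [vabs t = qR]. *)
have le1 : vabs (omega_coef i) ^+ (q ^ m) <= (qR^-1 ^+ i) ^+ m.+1.
  apply: (@le_trans _ _ ((qR^-1 ^+ i) ^+ (q ^ m))).
    by rewrite lerXn2r ?nnegrE ?vabs_ge0 ?exprn_ge0 ?vabs_omega_coef.
  rewrite ler_wiXn2l ?exprn_ge0 ?exprn_ile1 //.
  exact: ltn_expl _ (@finField_card_gt1 F).
have le2 : vabs t ^+ i <= qR ^+ i by rewrite lerXn2r ?nnegrE ?vabs_ge0 ?ler0n.
apply: le_trans (ler_pM _ _ le1 le2) _; rewrite ?exprn_ge0 ?vabs_ge0 //.
rewrite exprSr -mulrA -exprMn mulVf ?gt_eqF ?cardR_gt0 // expr1n mulr1.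
by rewrite -!exprM mulnC.
Qed.

Lemma omega_twist_vcvg (m : nat) t : (0 < m)%N -> vabs t <= qR ->
  vcvg (series (omega_term m t)) (omega_twist m t).
Proof.
move=> m_gt0 tq; have [|x sx] := vcvg_series (@Cinf_complete) (u := omega_term m t).
  apply: vcvg_squeeze (cvg_geometric0 1 (invq_pow_ge0_lt1 m_gt0)); near=> i.
  by rewrite subr0 mul1r vabs_omega_term.
by rewrite /omega_twist (vlim_vcvg sx).
Unshelve. all: by end_near. Qed.

Lemma omega_term0 (m : nat) t : omega_term m t 0 = 1.
Proof. by rewrite /omega_term /= expr1n mulr1. Qed.

(** The first term is 1 and the others are at most [qR^-1 ^+ m]. Hence the twists tend to 1 as [m]
    grows, which gives the infinite product its limit. *)
Lemma omega_twist_near1 (m : nat) t : (0 < m)%N -> vabs t <= qR ->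
  vabs (omega_twist m t - 1) <= qR^-1 ^+ m.
Proof.
move=> m_gt0 tq; have := vcvgB (omega_twist_vcvg m_gt0 tq) (vcvg_cst 1).
have := invq_pow_ge0_lt1 m_gt0 => /andP[b0 /ltW b1].
move/(@vcvg_vabs_le _ _ _ _ _ 1%N); apply => -[|n] // _.
rewrite /series /= big_nat_recl //= omega_term0 addrC addKr.
apply: vabs_sum_le => // i _.
by rewrite (le_trans (vabs_omega_term _ _ _)) // exprS ler_piMr // exprn_ile1.
Qed.

Lemma vabs_omega_twist (m : nat) t : (0 < m)%N -> vabs t <= qR -> vabs (omega_twist m t) = 1.
Proof.
move=> m_gt0 tq; rewrite -[omega_twist m t](subrK 1) addrC vabsD_dominant vabs1 //.
rewrite (le_lt_trans (omega_twist_near1 m_gt0 tq)) //.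
by case/andP: (invq_pow_ge0_lt1 m_gt0).
Qed.

Lemma omega_twist_neq0 (m : nat) t : (0 < m)%N -> vabs t <= qR -> omega_twist m t != 0.
Proof. by move=> m_gt0 tq; rewrite -vabs_eq0 vabs_omega_twist // oner_neq0. Qed.

Lemma omega_coef_FrobS (m i : nat) :
  omega_coef i.+1 ^+ (q ^ m.+1)
    = omega_coef i.+1 ^+ (q ^ m) - omega_coef i ^+ (q ^ m) / th ^+ (q ^ m).
Proof.
rewrite expnS exprM omega_coefE (expr_card_powB emb); congr (_ - _).
by rewrite exprMn exprVn.
Qed.

(** This is [tau^m] applied to [tau G = (1 - t / th) G]. *)
Lemma omega_twist_rec (m : nat) t : (0 < m)%N -> vabs t <= qR ->
  omega_twist m.+1 t = (1 - t / th ^+ (q ^ m)) * omega_twist m t.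
Proof.
move=> m_gt0 tq; have sG := omega_twist_vcvg m_gt0 tq.
apply: (vcvg_unique (iffRL (vcvgS _ _) (omega_twist_vcvg (ltn0Sn m) tq))).
have := vcvgB (iffRL (vcvgS _ _) sG) (vcvgMr (t / th ^+ (q ^ m)) sG).
rewrite mulrBl mul1r; congr vcvg; apply/funext => n.
rewrite /series /= !big_nat_recl //= !omega_term0 -addrA mulr_sumr -sumrB; congr (_ + _).
apply: eq_bigr => i _; rewrite /omega_term omega_coef_FrobS mulrBl; congr (_ - _).
by rewrite exprS; ring.
Qed.

Lemma omega_twist_prod (n : nat) t : vabs t <= qR ->
  omega_twist n.+1 t = \prod_(1 <= m < n.+1) (1 - t / th ^+ (q ^ m)) * omega_twist 1 t.
Proof.
move=> tq; elim: n => [|n IHn]; first by rewrite big_nil mul1r.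
by rewrite omega_twist_rec // IHn [in RHS]big_nat_recr //= mulrCA mulrA.
Qed.

(** At [t = th] the series telescopes: by [omega_coefE] its term of index [i.+1] is [th ^+ i.+1 *
    omega_coef i.+1 - th ^+ i * omega_coef i]. *)
Lemma omega_twist1_theta : vcvg (fun n => th ^+ n * omega_coef n) (omega_twist 1 th).
Proof.
have := iffRL (vcvgS _ _) (omega_twist_vcvg (ltn0Sn 0) (_ : vabs th <= qR)).
rewrite vabs_theta => /(_ (lexx _)); congr vcvg; apply/funext => n.
rewrite /series /=; elim: n => [|n IHn]; first by rewrite big_nat1 omega_term0 mulr1.
rewrite big_nat_recr // IHn /omega_term expn1 omega_coefE exprS /=.
by field; rewrite theta_neq0.
Qed.

(** * The infinite product and the value of the L-series *)

Lemma theta_pow_sub_neq0 (i : nat) : (0 < i)%N -> th - th ^+ (q ^ i) != 0.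
Proof.
by move=> i_gt0; rewrite -oppr_eq0 opprB carlitz_bracket_neq0.
Qed.

(** Each factor is the quotient of [1 - t / th ^+ (q ^ i)] by its value at [t = th], so the finite
    products are quotients of twists, and those of index [n.+1] tend to 1. *)
Lemma prod_theta_vcvg t : vabs t <= qR ->
  vcvg (fun n => \prod_(1 <= i < n.+1) ((t - th ^+ (q ^ i)) / (th - th ^+ (q ^ i))))
    (omega_twist 1 th / omega_twist 1 t).
Proof.
move=> tq; have thq : vabs th <= qR by rewrite vabs_theta.
have [n1 n2] : omega_twist 1 th != 0 /\ omega_twist 1 t != 0 by split; apply: omega_twist_neq0.
have prodE n : \prod_(1 <= i < n.+1) ((t - th ^+ (q ^ i)) / (th - th ^+ (q ^ i)))
    = (omega_twist 1 th / omega_twist 1 t) * (omega_twist n.+1 t / omega_twist n.+1 th).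
  have [n3 n4] : omega_twist n.+1 th != 0 /\ omega_twist n.+1 t != 0.
    by split; apply: omega_twist_neq0.
  have pE x : vabs x <= qR ->
      \prod_(1 <= m < n.+1) (1 - x / th ^+ (q ^ m)) = omega_twist n.+1 x / omega_twist 1 x.
    by move=> xq; rewrite omega_twist_prod // mulfK // omega_twist_neq0.
  transitivity ((omega_twist n.+1 t / omega_twist 1 t) / (omega_twist n.+1 th / omega_twist 1 th)).
    rewrite -!pE // -prodf_div big_nat_cond [RHS]big_nat_cond.
    apply: eq_bigr => i /andP[/andP[i_gt0 _] _].
    have thi : th ^+ (q ^ i) != 0 by rewrite expf_neq0 ?theta_neq0.
    have := theta_pow_sub_neq0 i_gt0; move: thi; set w := th ^+ _ => w0 thw.
    by field; rewrite w0 thw -opprB oppr_eq0 thw.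
  by field; rewrite n1 n2 n3.
suff h : vcvg (fun n => omega_twist n.+1 t / omega_twist n.+1 th) 1.
  have := vcvgMr (omega_twist 1 th / omega_twist 1 t) h; rewrite mulr1.
  by congr vcvg; apply/funext => n; rewrite prodE.
apply: vcvg_squeeze (cvg_geometric0 1 invq_ge0_lt1); near=> n.
have n3 : omega_twist n.+1 th != 0 by apply: omega_twist_neq0.
have -> : omega_twist n.+1 t / omega_twist n.+1 th - 1
    = ((omega_twist n.+1 t - 1) - (omega_twist n.+1 th - 1)) / omega_twist n.+1 th.
  by field.
have := invq_ge0_lt1 => /andP[b0 /ltW b1].
rewrite vabsM vabsV vabs_omega_twist // invr1 mulr1 mul1r.
by apply: vabsB_le; rewrite (le_trans (omega_twist_near1 _ _)) // ler_wiXn2l.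
Unshelve. all: by end_near. Qed.

Lemma chi_vabs_le1 xi (a : {poly F}) : vabs xi <= 1 -> vabs (chi xi a) <= 1.
Proof.
move=> xi1; rewrite /chi horner_coef; apply: vabs_sum_le => // i _.
rewrite vabsM vabsX (le_trans (ler_pM _ _ (_ : _ <= 1) (_ : _ <= 1))) ?mulr1 //
  ?exprn_ge0 ?vabs_ge0 ?exprn_ile1 ?vabs_ge0 //.
by rewrite coef_map_id0 ?vabs_embF_le1 // /embF rmorph0.
Qed.

Lemma L_chi_1_omega_twist xi : vabs xi <= 1 -> L_chi_1 xi (omega_twist 1 th / omega_twist 1 xi).
Proof.
move=> xi1; have xiq : vabs xi <= qR by rewrite (le_trans xi1) // ltW ?cardR_gt1.
pose J n : {fset {a : {poly F} | a \is monic}} := [fset a in pmap insub (monics n)]%fset.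
have inJ n a : (a \in J n) = (size (val a) <= n)%N.
  rewrite !inE mem_pmap; apply/mapP/idP => [[b + ab]|sa].
    by rewrite monicsP => /andP[_]; move: ab; case: insubP => // u _ <- [<-].
  by exists (val a); rewrite ?monicsP ?(valP a) ?valK.
have JE n (g : {poly F} -> C) : \sum_(a <- J n) g (val a) = \sum_(a <- monics n) g a.
  rewrite -(big_map val predT); apply: perm_big; apply: uniq_perm.
  - by rewrite map_inj_uniq ?fset_uniq //; apply: val_inj.
  - by rewrite filter_uniq ?polys_uniq.
  move=> a; rewrite monicsP; apply/mapP/andP => [[u + ->]|[am sa]].
    by rewrite inJ => ->; rewrite (valP u).
  by exists (Sub a am); rewrite ?inJ SubK.
apply: (@has_sum_exhaustion _ _ _ _ _ J).
  apply/vcvgS; under eq_fun do rewrite (JE _ (fun a => chi xi a / emb a)).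
  have := prod_theta_vcvg xiq; congr vcvg; apply/funext => n.
  rewrite -sum_monics_horner //; [exact: embA_inj|exact: theta_pow_inj].
move=> e e0; have /cvgr0Pnorm_lt/(_ e e0) := cvg_geometric0 1 invq_ge0_lt1.
have := invq_ge0_lt1 => /andP[b0 /ltW b1].
(* A monic polynomial outside [J n.+1] has degree greater than [n], so its term is at most
   [qR^-1 ^+ n]. *)
move=> near_e; apply: near_inftyS; move: near_e; apply: filterS => n.
rewrite mul1r /= ger0_norm ?exprn_ge0 // => ne a; rewrite inJ -ltnNge => ltna.
rewrite vabsM vabsV vabs_embA /absA (negPf (monic_neq0 (valP a))).
rewrite (le_lt_trans _ ne) // -exprVn -[leRHS]mul1r ler_pM ?vabs_ge0 ?exprn_ge0 ?chi_vabs_le1 //.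
rewrite ler_wiXn2l // -ltnS prednK //; exact: ltn_trans ltna.
Qed.

Lemma exists_root_minus_theta : exists lam : C, lam ^+ (q - 1) = - th.
Proof.
have [_ /(_ (q - 1)%N)] := cinf_algclosure C.
pose thK := toKinf_alg C (toKinf C (tofrac 'X)).
(* The axiom solves [x ^+ n = \sum_i P i * x ^+ i]; only the constant coefficient [- thK] is
   kept. *)
move=> /(_ (fun i => if i == 0%N then - thK else 0)) [|x xE].
  by rewrite subn_gt0 finField_card_gt1.
exists (toCinf C x); rewrite -rmorphXn xE.
have : (0 < q - 1)%N by rewrite subn_gt0 finField_card_gt1.
case: (q - 1)%N => // m _; rewrite big_ord_recl big1 ?addr0 ?mulr1 ?rmorphN //=.
by move=> i _; rewrite mul0r.
Qed.

(** * Periods *)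

Section Period.
Variables (lam : C) (lamE : lam ^+ (q - 1) = - th).

Lemma lam_neq0 : lam != 0.
Proof.
apply/eqP => lam0; have := theta_neq0; rewrite -oppr_eq0 -lamE lam0 expr0n.
by rewrite subn_eq0 leqNgt finField_card_gt1 eqxx.
Qed.

Lemma lam_Frob : lam ^+ q = - th * lam.
Proof. by rewrite -lamE -exprSr subn1 prednK ?finField_card_gt0. Qed.

(** Carlitz's product formula for the period: [omega_twist 1 th] is the inverse of the product of
    the [1 - th / th ^+ (q ^ i)], [i >= 1]. *)
Definition period0 : C := th * lam * omega_twist 1 th.

Lemma e_Car_period0_theta (n : nat) : e_Car (period0 / th ^+ n.+1) = lam * omega_coef n.
Proof.
(* The errors [del k] form a [th]-division tower, along which
   [vabs (th ^+ k.+1 * del k)] does not decrease, yet it tends to 0. *)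
pose del k := e_Car (period0 / th ^+ k.+1) - lam * omega_coef k.
have delE k : del k = th * del k.+1 + del k.+1 ^+ q.
  rewrite /del {1}(_ : period0 / th ^+ k.+1 = th * (period0 / th ^+ k.+2)); last first.
    by rewrite [th ^+ k.+2]exprS; field; rewrite expf_neq0 theta_neq0.
  rewrite e_Car_theta Frob1_B exprMn lam_Frob omega_coefE.
  by field; rewrite theta_neq0.
(* The error of [e_Car_approx] is quadratic in [th ^- k.+1], so it survives one multiplication by
   [th ^+ k.+1]. *)
have lim_e : vcvg (fun k => th ^+ k.+1 * (e_Car (period0 / th ^+ k.+1) - period0 / th ^+ k.+1)) 0.
  apply: vcvg_squeeze (cvg_geometric0 (vabs period0 ^+ 2) invq_ge0_lt1).
  have /cvgr0Pnorm_lt/(_ 1 ltr01) := cvg_geometric0 (vabs period0) invq_ge0_lt1.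
  apply: filterS => k; have := invq_ge0_lt1 => /andP[b0 /ltW b1].
  rewrite /= ger0_norm ?mulr_ge0 ?exprn_ge0 ?vabs_ge0 // => /ltW le1.
  have vle : vabs (period0 / th ^+ k.+1) <= vabs period0 * qR^-1 ^+ k.
    by rewrite vabs_theta_powM ler_wpM2l ?vabs_ge0 // ler_wiXn2l.
  rewrite subr0 vabsM; apply: le_trans (ler_wpM2l (vabs_ge0 _) (e_Car_approx (le_trans vle le1))) _.
  rewrite vabsX vabs_theta vabs_theta_powM exprMn mulrCA ler_wpM2l ?exprn_ge0 ?vabs_ge0 //.
  rewrite expr2 mulrA -exprMn mulfV ?gt_eqF ?cardR_gt0 // expr1n mul1r.
  by rewrite ler_wiXn2l.
have lim_del : vcvg (fun k => th ^+ k.+1 * del k) 0.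
  have lim_gam : vcvg (fun k => th * lam * (th ^+ k * omega_coef k)) period0.
    exact: vcvgMr omega_twist1_theta.
  have := vcvgB (vcvgD lim_e (vcvg_cst period0)) lim_gam.
  rewrite add0r subrr; congr vcvg; apply/funext => k.
  by rewrite /del exprS; field; rewrite expf_neq0 theta_neq0.
have [N NP] : exists N, forall k, (N <= k)%N -> del k = 0.
  have /vcvg0_vabs/cvgr0Pnorm_lt lim_vdel := lim_del.
  have [N _ Nle1] := lim_vdel 1 ltr01.
  (* Below value 1, the [q]-th power in [delE] is dominated by the linear term. *)
  have del_mono k : (N <= k)%N -> vabs (th ^+ k.+1 * del k) <= vabs (th ^+ k.+2 * del k.+1).
    move=> leNk; have := Nle1 k.+1 (leqW leNk).
    rewrite /= ger0_norm ?vabs_ge0 // => /ltW dk1.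
    have dk : vabs (del k.+1) <= 1.
      apply: le_trans dk1; rewrite vabsM vabsX vabs_theta ler_peMl ?vabs_ge0 //.
      by rewrite exprn_ege1 // ltW ?cardR_gt1.
    rewrite [th ^+ k.+2]exprSr -mulrA !vabsM ler_wpM2l ?vabs_ge0 //.
    rewrite delE -vabsM vabsD_le // vabsX vabsM (@le_trans _ _ (vabs (del k.+1))) //.
      by rewrite ler_iXnr ?finField_card_gt0 ?vabs_ge0.
    by rewrite vabs_theta ler_peMl ?vabs_ge0 // ltW ?cardR_gt1.
  exists N => k leNk; apply/eqP; rewrite -vabs_eq0 -[_ == _]negbK; apply/negP => dk0.
  have Dk0 : 0 < vabs (th ^+ k.+1 * del k).
    by rewrite vabs_gt0 mulf_neq0 ?expf_neq0 ?theta_neq0 // -vabs_eq0.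
  have [N' _ N'lt] := lim_vdel _ Dk0.
  have := N'lt (k + N')%N (leq_addl _ _); rewrite /= ger0_norm ?vabs_ge0 // ltNge.
  case/negP; elim: N' {N'lt} => [|N' IHN']; first by rewrite addn0.
  by rewrite (le_trans IHN') // addnS del_mono // (leq_trans leNk) ?leq_addr.
(* By [delE], vanishing descends from [del k.+1] to [del k]. *)
suff : del n = 0 by move/eqP; rewrite subr_eq0 => /eqP.
have : del (n + N)%N = 0 by rewrite NP ?leq_addl.
elim: N {NP} => [|N IHN]; first by rewrite addn0.
rewrite addnS => d0; apply: IHN.
by rewrite delE d0 mulr0 add0r expr0n -leqn0 leqNgt finField_card_gt0.
Qed.

(** One more step of the tower above its term [lam] at 0: [th * lam + lam ^+ q = 0]. *)
Lemma e_Car_period0 : e_Car period0 = 0.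
Proof.
have -> : period0 = th * (period0 / th ^+ 1) by rewrite expr1; field; rewrite theta_neq0.
rewrite e_Car_theta e_Car_period0_theta mulr1 lam_Frob.
by rewrite mulNr subrr.
Qed.

(** The right-hand side is the coefficient of [t ^+ n] in the product of [a], read as a polynomial
    in [t], and [s_Car w]. The terms with [j > n] drop out because [e_Car] kills polynomial
    multiples of [w]. *)
Lemma e_Car_emb_period (w : C) (a : {poly F}) (n : nat) :
  (forall b, e_Car (emb b * w) = 0) ->
  e_Car (emb a * w / th ^+ n.+1)
    = \sum_(j < size a | (j <= n)%N) embF C a`_j * s_Car w (n - j).
Proof.
move=> ew0.
have -> : emb a * w / th ^+ n.+1 = \sum_(j < size a) embF C a`_j * (th ^+ j * w / th ^+ n.+1).
  rewrite -[in LHS](coefK a) poly_def rmorph_sum !mulr_suml; apply: eq_bigr => j _.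
  by rewrite -mul_polyC rmorphM rmorphXn -!mulrA.
rewrite e_Car_sum [RHS]big_mkcond; apply: eq_bigr => j _; rewrite e_CarZ.
case: leqP => [lejn|ltnj].
  rewrite /s_Car; congr (_ * e_Car _); rewrite -subSn // -[in LHS](subnK (leqW lejn)) exprD.
  by field; rewrite !expf_neq0 ?theta_neq0.
rewrite -[X in th ^+ X](subnK ltnj) exprD mulrAC mulfK ?expf_neq0 ?theta_neq0 //.
by rewrite -rmorphXn ew0 mulr0.
Qed.

Lemma s_Car_vcvg (w : C) : vcvg (s_Car w) 0.
Proof.
apply: vcvg_squeeze (cvg_geometric0 (vabs w) invq_ge0_lt1).
have /cvgr0Pnorm_lt/(_ 1 ltr01) := cvg_geometric0 (vabs w) invq_ge0_lt1.
apply: filterS => n; have := invq_ge0_lt1 => /andP[b0 /ltW b1].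
rewrite /= ger0_norm ?mulr_ge0 ?exprn_ge0 ?vabs_ge0 // => /ltW le1.
have vle : vabs (w / th ^+ n.+1) <= vabs w * qR^-1 ^+ n.
  by rewrite vabs_theta_powM ler_wpM2l ?vabs_ge0 // ler_wiXn2l.
have z1 := le_trans vle le1.
rewrite subr0; apply: le_trans vle; rewrite /s_Car -[X in vabs X <= _](subrK (w / th ^+ n.+1)).
rewrite vabsD_le // (le_trans (e_Car_approx z1)) //.
by rewrite ler_iXnr ?vabs_ge0.
Qed.

(* If [period0 = emb a * w], the power series [lam * omega_coef], whose largest
   coefficient is at 0 only, is the product of the polynomial [a] and [s_Car w]:
   looking at the last large coefficient of the latter shows that [a] is constant. *)
Lemma fundamental_period_period0 (w : C) : fundamental_period w ->
  exists2 c : F, c != 0 &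
    period0 = embF C c * w /\ forall n, lam * omega_coef n = embF C c * s_Car w n.
Proof.
move=> fw; have ew0 b : e_Car (emb b * w) = 0 by apply/fw; exists b.
have [a aE] := iffLR (fw _) e_Car_period0.
have lamE_a n : lam * omega_coef n = \sum_(j < size a | (j <= n)%N) embF C a`_j * s_Car w (n - j).
  by rewrite -e_Car_period0_theta aE e_Car_emb_period.
have a_neq0 : a != 0.
  apply/eqP => a0; have := lamE_a 0; rewrite a0 size_poly0 big_ord0 mulr1 => /eqP.
  by rewrite (negPf lam_neq0).
have [D szD] : exists D, size a = D.+1.
  by exists (size a).-1; rewrite prednK // size_poly_gt0.
have aD : a`_D != 0 by rewrite -lead_coef_eq0 lead_coefE szD in a_neq0.
have lam_gt0 : 0 < vabs lam by rewrite vabs_gt0 lam_neq0.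
pose large j := vabs lam <= vabs (s_Car w j).
have large0 : large 0%N.
  have := lamE_a 0%N; rewrite szD mulr1 big_mkcond big_ord_recl /= big1 ?addr0; last by [].
  by rewrite /large => ->; rewrite vabsM ler_piMl ?vabs_ge0 ?vabs_embF_le1.
have [M largeM] : exists M, forall j, large j -> (j <= M)%N.
  have /vcvg0_vabs/cvgr0Pnorm_lt/(_ _ lam_gt0)[M _ MP] := s_Car_vcvg w.
  exists M => j; rewrite leqNgt; apply: contraTN => ltMj.
  by have := MP j (ltnW ltMj); rewrite /= ger0_norm ?vabs_ge0 // -ltNge.
have [j largej jmax] := ex_maxnP (ex_intro _ 0%N large0) largeM.
(* In the coefficient of index [D + j], the leading coefficient of [a] meets the last large
   [s_Car w j]; the other terms involve later, smaller coefficients. *)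
have lam_le : vabs lam <= vabs (lam * omega_coef (D + j)).
  have -> : lam * omega_coef (D + j) = embF C a`_D * s_Car w j
      + \sum_(k < D) embF C a`_k * s_Car w (D + j - k).
    rewrite lamE_a szD big_mkcond big_ord_recr /= leq_addr addKn addrC; congr (_ + _).
    by apply: eq_bigr => k _; rewrite (leq_trans (ltnW (ltn_ord k))) ?leq_addr.
  rewrite vabsD_dominant vabsM vabs_embF // mul1r //.
  apply: lt_le_trans largej; apply: vabs_sum_lt => // k _.
  rewrite vabsM (le_lt_trans (ler_piMl _ (vabs_embF_le1 _))) ?vabs_ge0 // ltNge.
  apply/negP => /jmax; rewrite leqNgt; case/negP.
  by rewrite -addnBAC ?(ltnW (ltn_ord k)) // -[ltnLHS]add0n ltn_add2r subn_gt0.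
have D0 : D = 0%N.
  apply/eqP; rewrite -leqn0 leqNgt; apply/negP => D_gt0; move: lam_le.
  rewrite vabsM -[leLHS]mulr1 ler_pM2l // => le1; have := le_trans le1 (vabs_omega_coef _).
  have := invq_ge0_lt1 => /andP[b0 b1].
  by rewrite leNgt exprn_ilt1 // -lt0n addn_gt0 D_gt0.
have aC : a = (a`_0)%:P by apply: size1_polyC; rewrite szD D0.
exists a`_0; first by rewrite -D0.
split=> [|n]; first by rewrite aE {1}aC.
by rewrite lamE_a szD D0 big_mkcond big_ord1 /= subn0.
Qed.

(** * The equation satisfied by [rho] *)

Lemma ps_eval_tau_s_Car (w xi : C) (c : F) : vabs xi <= qR -> c != 0 ->
  (forall n, lam * omega_coef n = embF C c * s_Car w n) ->
  ps_eval (tau (s_Car w)) xi = lam ^+ q * omega_twist 1 xi / embF C c.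
Proof.
move=> xiq c0 lam_s.
have c0' : embF C c != 0 by rewrite -vabs_eq0 vabs_embF ?oner_neq0.
apply: vlim_vcvg; have := vcvgMr (lam ^+ q / embF C c) (omega_twist_vcvg (ltn0Sn 0) xiq).
rewrite mulrAC; congr vcvg; apply/funext => n.
rewrite /series /= mulr_sumr; apply: eq_bigr => i _.
rewrite /tau; have -> : s_Car w i = lam * omega_coef i / embF C c by rewrite lam_s mulrC mulKf.
have := embF_Frob 1 c; rewrite expn1 => cq.
by rewrite /omega_term expn1 !exprMn exprVn cq; ring.
Qed.

(** The [q ^ r]-th power twists the coefficients [r] more times and fixes [xi]. *)
Lemma omega_twist1_Frob (r : nat) (xi : C) : vabs xi <= qR -> xi ^+ (q ^ r) = xi ->
  omega_twist 1 xi ^+ (q ^ r) = omega_twist r.+1 xi.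
Proof.
move=> xiq xir; apply: (vcvg_unique (vcvgX _ (omega_twist_vcvg (ltn0Sn 0) xiq))).
have := omega_twist_vcvg (ltn0Sn r) xiq; congr vcvg; apply/funext => n.
rewrite /series /= (expr_card_pow_sum emb); apply: eq_bigr => i _.
by rewrite /omega_term exprMn -!exprM -expnD add1n [in RHS]mulnC exprM xir.
Qed.

Lemma lam_pow (r : nat) :
  (lam ^+ q) ^+ (q ^ r) = lam ^+ q * \prod_(1 <= m < r.+1) (- th ^+ (q ^ m)).
Proof.
elim: r => [|r IHr]; first by rewrite big_nil mulr1 expr1.
rewrite [in RHS]big_nat_recr //= mulrA -IHr {1}lam_Frob exprMn.
by rewrite (expr_card_powN emb) mulrC -exprM -expnS.
Qed.

(** After multiplication by [rho] the left-hand side is a Frobenius power: it fixes [embF C c] and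
    turns [(tau G)(xi)] into [(tau^(r+1) G)(xi)], which [omega_twist_prod] compares with
    [(tau G)(xi)]. *)
Lemma rho_pow (r : nat) (xi : C) (c : F) : vabs xi <= qR -> c != 0 ->
  xi ^+ (q ^ r) = xi ->
  (lam ^+ q * omega_twist 1 xi / embF C c) ^+ (q ^ r - 1)
    = \prod_(1 <= m < r.+1) (xi - th ^+ (q ^ m)).
Proof.
move=> xiq c0 xir.
have c0' : embF C c != 0 by rewrite -vabs_eq0 vabs_embF ?oner_neq0.
have G0 : omega_twist 1 xi != 0 by apply: omega_twist_neq0.
set rho := _ / _.
have rho0 : rho != 0 by rewrite !mulf_neq0 ?invr_eq0 ?expf_neq0 ?lam_neq0.
apply: (mulIf rho0); rewrite -exprSr subn1 prednK ?expn_gt0 ?finField_card_gt0 //.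
rewrite !exprMn exprVn embF_Frob omega_twist1_Frob // omega_twist_prod // lam_pow.
have -> : \prod_(1 <= m < r.+1) (xi - th ^+ (q ^ m))
    = \prod_(1 <= m < r.+1) (- th ^+ (q ^ m)) * \prod_(1 <= m < r.+1) (1 - xi / th ^+ (q ^ m)).
  rewrite -big_split; apply: eq_bigr => m _ /=.
  by field; rewrite expf_neq0 ?theta_neq0.
by rewrite /rho; ring.
Qed.
End Period.
End Cinfty.

Theorem corollary2 (R : realType) (F : finFieldType) (C : cinfty R F)
    (piC : C) (hpi : fundamental_period piC)
    (r : nat) (hr : (0 < r)%N)
    (xi : C) (hxi_alg : algebraicOver (@embF R F C) xi)
    (hxi : xi ^+ (#|F| ^ r) = xi) :
  let rho := ps_eval (tau (s_Car piC)) xi in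
  [/\ rho != 0,
      rho ^+ (#|F| ^ r - 1) =
        \prod_(1 <= m < r.+1) (xi - theta C ^+ (#|F| ^ m))
    & L_chi_1 xi (- (piC / rho))].
Proof.
(* [xi] is 0 or a root of unity. *)
have xi_le1 : vabs xi <= 1.
  have [->|xi0] := eqVneq xi 0; first by rewrite vabs0.
  have n_gt1 : (1 < #|F| ^ r)%N by rewrite -(exp1n r) ltn_exp2r ?finField_card_gt1.
  rewrite (@vabs_expr1 _ _ _ (#|F| ^ r).-1) //; first by rewrite -subn1 subn_gt0.
  by apply: (mulIf xi0); rewrite -exprSr prednK ?hxi ?mul1r // ltnW.
have xi_leq : vabs xi <= #|F|%:R by rewrite (le_trans xi_le1) // ler1n finField_card_gt0.
have [lam lamE] := exists_root_minus_theta C.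
have [c c0 [piE lam_s]] := fundamental_period_period0 lamE hpi.
have c0' : embF C c != 0 by rewrite -vabs_eq0 vabs_embF ?oner_neq0.
have G0 : omega_twist 1 xi != 0 by apply: omega_twist_neq0.
have lam0 := lam_neq0 lamE.
rewrite /= (ps_eval_tau_s_Car xi_leq c0 lam_s); split.
- by rewrite !mulf_neq0 ?invr_eq0 ?expf_neq0.
- exact: rho_pow.
(* The constant [c] divides both [piC] and [rho], so it cancels, and [lam ^+ q = - th * lam] absorbs
   the sign. *)
have -> : - (piC / (lam ^+ #|F| * omega_twist 1 xi / embF C c))
    = omega_twist 1 (theta C) / omega_twist 1 xi.
  have -> : piC = period0 lam / embF C c by rewrite piE mulrC mulKf.
  rewrite lam_Frob // /period0; field.
  by rewrite G0 (c0' : embA C c%:P != 0) lam0 oppr_eq0 (theta_neq0 C).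
exact: L_chi_1_omega_twist.
Qed.
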